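(* Let $\mathcal{A}$ be a minimally self-adjusting BST algorithm and suppose there are constants $\epsilon>0$, $c>0$, $D>0$ such that for every access performed by $\mathcal{A}$: (i) every node $x$ on the search path loses at least $(\frac12+\epsilon)\,d(x)-c$ ancestors, and (ii) every node on the search path other than the accessed element gains at most $D$ new descendants. Then $\mathcal{A}$ satisfies the access lemma.
   Context: Keys $[n]$; for a BST $T$ and node $a$, $T(a)$ is the set of keys in the subtree rooted at $a$. Weights $w:[n]\to\mathbb{R}_{>0}$, $w(S)=\sum_{a\in S}w(a)$, $W=w([n])$; $\Phi_T=\sum_{a\in[n]}\log_2 w(T(a))$. A minimally self-adjusting BST algorithm, on access to $s$ in $T$ with search path $P$ (nodes on the root-to-$s$ path including $s$), replaces $P$ by a BST $A$ on node set $P$ with root $s$ (the after-tree), reattaching the subtrees hanging off $P$ in the unique order-consistent way, producing $T'$; cost $|P|$. It satisfies the access lemma if there is a constant $c'$ such that always $|P|\le\Phi_T-\Phi_{T'}+c'(1+\log_2\frac{W}{w(s)})$ (for all $n,T,w,s$ and all $T'$ the algorithm can produce). For nodes $x,y\in P$: if $y$ is an ancestor of $x$ in the search path but not in the after-tree $A$, then $x$ loses the ancestor $y$ and $y$ loses the descendant $x$; if $y$ is an ancestor of $x$ in $A$ but not in the search path, $x$ gains the ancestor $y$ and $y$ gains the descendant $x$. Only nodes of $P$ count as ancestors/descendants here (not nodes of the pendent subtrees). $d(x)$ denotes the number of ancestors of $x$ in the search path. *)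

(* Defs.v *)
From mathcomp Require Import all_boot all_order all_algebra.
From mathcomp Require Import reals exp.
Set Implicit Arguments.
Unset Strict Implicit.
Unset Printing Implicit Defensive.
Import Order.TTheory GRing.Theory Num.Theory.
Local Open Scope ring_scope.

(* The n keys are represented by 'I_n = {0, .., n-1} in place of {1, .., n}. *)
Inductive tree (n : nat) : Type :=
  | Leaf
  | Node of tree n & 'I_n & tree n.
Arguments Leaf {n}.

Section Trees.
Variable n : nat.
Implicit Types (t T A : tree n) (s x y a : 'I_n).

Fixpoint inorder t : seq 'I_n :=
  if t is Node l k r then inorder l ++ k :: inorder r else [::].

Definition keys t : {set 'I_n} := [set x in inorder t].

Definition root_key t : option 'I_n := if t is Node _ k _ then Some k else None.

Definition bst_on (S : {set 'I_n}) t : Prop :=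
  sorted (fun x y : 'I_n => (x < y)%N) (inorder t) /\ keys t = S.

(* Leaf if a does not occur in the search tree t. *)
Fixpoint subtree t a : tree n :=
  if t is Node l k r then
    if a == k then t
    else if (a < k)%N then subtree l a else subtree r a
  else Leaf.

Definition subkeys t a : {set 'I_n} := keys (subtree t a).

Fixpoint search_path t s : seq 'I_n :=
  if t is Node l k r then
    k :: (if s == k then [::]
          else if (s < k)%N then search_path l s else search_path r s)
  else [::].

Definition path_set T s : {set 'I_n} := [set x in search_path T s].

(* y is a proper ancestor of x in t. *)
Definition ancestor t y x : bool := (x != y) && (x \in subkeys t y).

(* The subtrees hanging off the search path to s, from left to right; absent
   children of path nodes count as empty subtrees, so that there is exactly one
   more of them than there are nodes on the path. *)
Fixpoint pendants t s : seq (tree n) :=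
  if t is Node l k r then
    if s == k then [:: l; r]
    else if (s < k)%N then rcons (pendants l s) r
    else l :: pendants r s
  else [:: Leaf].

(* Replaces the leaves of A, from left to right, by the trees of hs. *)
Fixpoint graft A (hs : seq (tree n)) : tree n :=
  if A is Node l k r then
    let m := (size (inorder l)).+1 in
    Node (graft l (take m hs)) k (graft r (drop m hs))
  else head Leaf hs.

(* The tree after an access to s in T with after-tree A.  The i-th leaf of a
   search tree on the path nodes is its i-th gap between these nodes, hence
   filling leaves in order is the only order-consistent reattachment. *)
Definition rearranged T s A : tree n := graft A (pendants T s).

Definition is_after_tree T s A : Prop :=
  bst_on (path_set T s) A /\ root_key A = Some s.

(* For x, y on the search path, being an ancestor in T is the same as being an
   ancestor in the search path; A only contains nodes of the path. *)
Definition path_ancestors T s x : {set 'I_n} :=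
  [set y in path_set T s | ancestor T y x].

Definition lost_ancestors T s A x : {set 'I_n} :=
  [set y in path_set T s | ancestor T y x & ~~ ancestor A y x].

Definition gained_descendants T s A y : {set 'I_n} :=
  [set x in path_set T s | ~~ ancestor T y x & ancestor A y x].

End Trees.

(* A possibly nondeterministic or history-dependent algorithm, given by its
   after-trees: alg n T s A means that, on access to s in T, the algorithm can
   use the after-tree A. *)
Definition algorithm := forall n : nat, tree n -> 'I_n -> tree n -> Prop.

Definition minimally_self_adjusting (alg : algorithm) : Prop :=
  forall (n : nat) (T : tree n) (s : 'I_n), bst_on [set: 'I_n] T ->
    (exists A, alg n T s A) /\ (forall A, alg n T s A -> is_after_tree T s A).

Section Potential.
Variable R : realType.

Definition log2 (x : R) : R := ln x / ln 2.

Definition weight n (w : 'I_n -> R) (S : {set 'I_n}) : R := \sum_(a in S) w a.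

Definition potential n (w : 'I_n -> R) (T : tree n) : R :=
  \sum_(a < n) log2 (weight w (subkeys T a)).

Definition access_lemma (alg : algorithm) : Prop :=
  exists c' : R,
    forall (n : nat) (T : tree n) (w : 'I_n -> R) (s : 'I_n) (A : tree n),
      bst_on [set: 'I_n] T -> (forall a, 0 < w a) -> alg n T s A ->
      #|path_set T s|%:R <=
        potential w T - potential w (rearranged T s A)
        + c' * (1 + log2 (weight w [set: 'I_n] / w s)).

End Potential.

(* Main.v *)
Require Import Defs.
From mathcomp Require Import all_boot all_order all_algebra.
From mathcomp Require Import reals sequences exp.
From mathcomp Require Import zify ring lra.
Set Implicit Arguments.
Unset Strict Implicit.
Unset Printing Implicit Defensive.
Import Order.TTheory GRing.Theory Num.Theory.
Local Open Scope ring_scope.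

(* Split the nodes of the search path into those left and those right of s, and
   let B = ln (W / w(s)).  Consider the left nodes a_0 < a_1 < ..., the right
   ones being symmetric.  At most N new descendants are gained, so T'(a_j) lies
   in T(a_(j-N)).  Call a_j shrunk if it loses a deeper left node x.  The
   lowest common ancestor of a_j and x in the after-tree gains all left nodes
   from a_j up to itself, hence is at most a_(j+N), and T'(a_j) is disjoint from
   T(a_(j+N+1)).  By concavity of ln, for any K,
     ln w(T'(a_j)) <= ln w(T(a_(j-N))) - K
                      + e^K (ln w(T(a_(j-N))) - ln w(T(a_(j+N+1)))),
   and the differences of logarithms telescope to O(N B).  So the potential
   drops by K per shrunk node, up to O(B).  The loss condition at the deepest
   left node and at the deepest right node gives at least 2 eps |P| - O(1)
   shrunk nodes, and K = ln 2 / (2 eps) turns this into |P|. *)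

(* The subtree key sets of a search tree with key set 'I_n.  The order of the keys
   enters only through rk, so that reversing rk exchanges left and right. *)
Record search_family (n : nat) (rk : 'I_n -> nat) (T : 'I_n -> {set 'I_n}) : Prop :=
  SearchFamily {
    family_refl : forall x, x \in T x;
    family_trans : forall x y, y \in T x -> T y \subset T x;
    family_anti : forall x y, y \in T x -> x \in T y -> x = y;
    family_convex : forall a x y k, x \in T a -> y \in T a ->
      (rk x <= rk k)%N -> (rk k <= rk y)%N -> k \in T a;
    family_lca : forall x y, (rk x <= rk y)%N ->
      exists z, [/\ (rk x <= rk z)%N, (rk z <= rk y)%N, x \in T z & y \in T z] }.

(** Lets each result about nodes left of [s] be reused for those on the right. The truncated [n - x]
    reverses the order because every key is below [n]. *)
Lemma search_family_rev n (T : 'I_n -> {set 'I_n}) :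
  search_family val T -> search_family (fun x : 'I_n => (n - x)%N) T.
Proof.
case=> Trefl Ttrans Tanti Tconv Tlca; split=> //.
- move=> a x y k xa ya lexk leky.
  by apply: (Tconv a y x k) => //=; have := ltn_ord x; have := ltn_ord k; lia.
- move=> x y lexy; have [|z [? ? ? ?]] := Tlca y x.
    by rewrite /=; have := ltn_ord x; lia.
  by exists z; split=> //=; move=> *; simpl in *; lia.
Qed.

(** Keeps only comparisons of natural numbers, so that [lia] need not digest facts about sets and
    trees. *)
Ltac order_lia :=
  repeat match goal with H : ?P |- _ =>
    lazymatch P with
    | is_true (leq _ _) => fail
    | leq _ _ = false => fail
    | @eq nat _ _ => fail
    | _ => clear H
    end
  end; lia.

(** * Subtree key sets of a search tree *)

Section SearchTrees.
Variable n : nat.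
Implicit Types (t l r A : tree n) (x y k a s : 'I_n) (hs : seq (tree n)).

Definition search_tree t := sorted (fun x y : 'I_n => (x < y)%N) (inorder t).

Let lt_trans : transitive (fun x y : 'I_n => (x < y)%N).
Proof. by move=> y x z; apply: ltn_trans. Qed.

Lemma in_keys_node l k r x :
  (x \in keys (Node l k r)) = [|| x \in keys l, x == k | x \in keys r].
Proof. by rewrite !inE /= mem_cat inE. Qed.

Lemma search_tree_node l k r : search_tree (Node l k r) ->
  [/\ search_tree l, search_tree r,
      forall x, x \in keys l -> (x < k)%N & forall x, x \in keys r -> (k < x)%N].
Proof.
rewrite /search_tree /= !(sorted_pairwise lt_trans) pairwise_cat /=.
case/and3P=> /allrelP lk pl /andP[/allP kr pr]; split=> // x.
  by rewrite inE => xl; apply: lk => //; rewrite inE eqxx.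
by rewrite inE; apply: kr.
Qed.

Lemma subkeys_node l k r a : subkeys (Node l k r) a =
  if a == k then keys (Node l k r) else if (a < k)%N then subkeys l a else subkeys r a.
Proof. by rewrite /subkeys /=; case: eqP => //; case: ltnP. Qed.

Lemma subkeys_leaf a : subkeys Leaf a = set0.
Proof. by apply/setP=> x; rewrite !inE. Qed.

Lemma subkeys_sub t a : subkeys t a \subset keys t.
Proof.
elim: t => [|l IHl k r IHr]; first by rewrite subkeys_leaf sub0set.
apply/subsetP=> x; rewrite subkeys_node; case: ifP => // _; rewrite in_keys_node.
by case: ifP => _ => [/(subsetP IHl)->|/(subsetP IHr)->] //; rewrite !orbT.
Qed.

Lemma subkeysW t a x : x \in subkeys t a -> x \in keys t.
Proof. exact: (subsetP (subkeys_sub t a)). Qed.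

Lemma subkeys_refl t a : search_tree t -> a \in keys t -> a \in subkeys t a.
Proof.
elim: t => [|l IHl k r IHr]; first by rewrite !inE.
move=> /search_tree_node[sl sr lk kr]; rewrite subkeys_node.
case: eqP => // /eqP nak; rewrite in_keys_node (negPf nak) /=.
case: ltnP => [ak /orP[|/kr]|ka /orP[/lk|]].
- exact: IHl.
- by order_lia.
- by order_lia.
- exact: IHr.
Qed.

Lemma subkeys_trans t a x : search_tree t ->
  x \in subkeys t a -> subkeys t x \subset subkeys t a.
Proof.
elim: t => [|l IHl k r IHr]; first by rewrite subkeys_leaf inE.
move=> st; have /search_tree_node[sl sr lk kr] := st; rewrite (subkeys_node _ _ _ a).
case: ifP => _; first by rewrite subkeys_sub.
case: ltnP => _ xa; rewrite subkeys_node.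
  have xk := lk _ (subkeysW xa).
  by rewrite ifF ?xk ?IHl //; apply/eqP=> E; rewrite E ltnn in xk.
have kx := kr _ (subkeysW xa); rewrite ifF ?ifF ?IHr //; first by order_lia.
by apply/eqP=> E; rewrite E ltnn in kx.
Qed.

Lemma subkeys_anti t a x : search_tree t ->
  x \in subkeys t a -> a \in subkeys t x -> a = x.
Proof.
elim: t => [|l IHl k r IHr]; first by rewrite subkeys_leaf inE.
move=> st; have /search_tree_node[sl sr lk kr] := st; rewrite !subkeys_node.
case: (eqVneq a k) => [->|nak]; case: (eqVneq x k) => [->|nxk] //.
- by case: ltnP => _ _ => [/subkeysW/lk|/subkeysW/kr]; rewrite ltnn.
- by case: ltnP => _ => [/subkeysW/lk|/subkeysW/kr]; rewrite ltnn.
- case: ltnP => [ak|ka].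
    by move=> xa; rewrite (lk _ (subkeysW xa)); apply: IHl.
  move=> xa; have kx := kr _ (subkeysW xa); rewrite ifF; first exact: IHr.
  by order_lia.
Qed.

Lemma subkeys_convex t a x y k : search_tree t -> x \in subkeys t a ->
  y \in subkeys t a -> k \in keys t -> (x <= k)%N -> (k <= y)%N -> k \in subkeys t a.
Proof.
elim: t => [|l IHl h r IHr]; first by rewrite subkeys_leaf inE.
move=> /search_tree_node[sl sr lk kr]; rewrite subkeys_node.
case: ifP => // _; rewrite in_keys_node; case: ifP => _ xa ya kt xk ky.
  apply: IHl => //; case/or3P: kt => // [/eqP E|/kr].
    by have := lk _ (subkeysW ya); rewrite -E; order_lia.
  by have := lk _ (subkeysW ya); order_lia.
apply: IHr => //; case/or3P: kt => // [/lk|/eqP E].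
  by have := kr _ (subkeysW xa); order_lia.
by have := kr _ (subkeysW xa); rewrite -E; order_lia.
Qed.

(** The witness is the first key between [x] and [y] met on the way down from the root: up to there
    both lie in the same subtree. *)
Lemma subkeys_lca t x y : search_tree t -> x \in keys t -> y \in keys t ->
  (x <= y)%N ->
  exists z : 'I_n, [/\ (x <= z)%N, (z <= y)%N, x \in subkeys t z & y \in subkeys t z].
Proof.
elim: t => [|l IHl k r IHr]; first by rewrite inE.
move=> /search_tree_node[sl sr lk kr] xt yt xy.
case: (ltnP k x) => kx.
  have inr (u : 'I_n) : (k < u)%N -> u \in keys (Node l k r) -> u \in keys r.
    move=> ku; rewrite in_keys_node => /or3P[/lk|/eqP E|] //; first by order_lia.
    by rewrite E ltnn in ku.
  have [||//|z [xz zy xz' yz']] := IHr sr; [exact: inr|apply: inr => //; order_lia|].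
  have kz : (k < z)%N by order_lia.
  exists z; rewrite subkeys_node ifF ?ifF //; first by order_lia.
  by apply/eqP=> E; rewrite E ltnn in kz.
case: (ltnP y k) => yk; last first.
  by exists k; rewrite subkeys_node eqxx.
have inl (u : 'I_n) : (u < k)%N -> u \in keys (Node l k r) -> u \in keys l.
  move=> uk; rewrite in_keys_node => /or3P[|/eqP E|/kr] //; last by order_lia.
  by rewrite E ltnn in uk.
have [||//|z [xz zy xz' yz']] := IHl sl; [apply: inl => //; order_lia|exact: inl|].
have zk : (z < k)%N by order_lia.
exists z; rewrite subkeys_node ifF ?zk //.
by apply/eqP=> E; rewrite E ltnn in zk.
Qed.

Lemma subkeys_family t : bst_on [set: 'I_n] t -> search_family val (subkeys t).
Proof.
case=> st tT; have inT x : x \in keys t by rewrite tT inE.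
split=> [x|x y|x y|a x y k xa ya|x y].
- exact: subkeys_refl.
- exact: subkeys_trans.
- exact: subkeys_anti.
- exact: subkeys_convex.
- exact: subkeys_lca.
Qed.

(** * Search paths and grafted trees *)

(** The search always descends into the child whose subtree holds [s]. This turns paths into subtree
    key sets, the only language of the later counting. *)
Lemma mem_search_path t s x : search_tree t -> s \in keys t ->
  (x \in search_path t s) = (x \in keys t) && (s \in subkeys t x).
Proof.
elim: t => [|l IHl k r IHr]; first by rewrite inE.
move=> /search_tree_node[sl sr lk kr] st.
rewrite /= inE; rewrite in_keys_node subkeys_node.
case: (eqVneq x k) => [->|nxk] /=; first by rewrite orbT st.
have inr : (k < s)%N -> s \in keys r.
  move=> ku; move: st; rewrite in_keys_node => /or3P[/lk|/eqP E|] //; first by order_lia.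
  by rewrite E ltnn in ku.
have inl : (s < k)%N -> s \in keys l.
  move=> ku; move: st; rewrite in_keys_node => /or3P[|/eqP E|/kr] //; last by order_lia.
  by rewrite E ltnn in ku.
have [Esk|nsk] := eqVneq s k.
  rewrite inE; apply/esym/negbTE; rewrite negb_and orbC; apply/orP; left.
  by case: ifP => _; apply/negP=> /subkeysW; first [move/lk|move/kr]; rewrite Esk ltnn.
case: ifP => sk.
  rewrite IHl ?inl //; case: ifP => xk.
    case: (boolP (x \in keys l)) => //= _; apply/esym/negbTE; rewrite negb_and.
    by apply/orP; left; apply/negP=> /kr; order_lia.
  have -> : (x \in keys l) = false by apply/negP=> /lk; order_lia.
  apply/esym/negbTE; rewrite negb_and orbC; apply/orP; left.
  by apply/negP=> /subkeysW/kr; order_lia.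
have ks : (k < s)%N.
  by rewrite ltn_neqAle eq_sym (inj_eq val_inj) nsk; order_lia.
rewrite IHr ?inr //; case: ifP => xk.
  have -> : (x \in keys r) = false by apply/negP=> /kr; order_lia.
  apply/esym/negbTE; rewrite negb_and orbC; apply/orP; left.
  by apply/negP=> /subkeysW/lk; order_lia.
case: (boolP (x \in keys r)) => /=; first by rewrite orbT.
rewrite orbF => _.
by have -> : (x \in keys l) = false by apply/negP=> /lk; order_lia.
Qed.

(* T is path_tree T s with the pendants of T grafted back, so T and the rearranged
   tree are treated alike. *)
Fixpoint path_tree t s : tree n :=
  if t is Node l k r then
    if s == k then Node Leaf k Leaf
    else if (s < k)%N then Node (path_tree l s) k Leaf
    else Node Leaf k (path_tree r s)
  else Leaf.

Lemma size_pendants t s : size (pendants t s) = (size (inorder (path_tree t s))).+1.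
Proof.
elim: t => //= l IHl k r IHr; case: ifP => _ //; case: ifP => _ /=.
  by rewrite size_rcons size_cat IHl /= addn1.
by rewrite IHr.
Qed.

Lemma graft_path_tree t s : graft (path_tree t s) (pendants t s) = t.
Proof.
elim: t => //= l IHl k r IHr; case: ifP => _ //; case: ifP => _ /=.
  rewrite -size_pendants -cats1 take_size_cat // drop_size_cat //=.
  by rewrite IHl.
by rewrite drop0 IHr.
Qed.

Lemma keys_path_tree t s : keys (path_tree t s) = path_set t s.
Proof.
apply/setP=> x; rewrite !inE.
elim: t => //= l IHl k r IHr; case: ifP => _ //; case: ifP => _ /=.
  by rewrite mem_cat !inE IHl orbC.
by rewrite !inE IHr.
Qed.

Lemma subseq_path_tree t s : subseq (inorder (path_tree t s)) (inorder t).
Proof.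
elim: t => //= l IHl k r IHr; case: ifP => _; last case: ifP => _ /=.
- by rewrite /= -[[:: k]]cat0s cat_subseq ?sub0seq //= eqxx sub0seq.
- by apply: cat_subseq => //=; rewrite eqxx sub0seq.
- rewrite -[_ :: _]cat0s cat_subseq ?sub0seq //=.
  by rewrite eqxx.
Qed.

(** In-order sequence of a graft: the trees of [hs] fill the gaps around the keys [ks] of the
    after-tree. The shape of the after-tree does not enter, hence rearranging keeps the sequence of
    keys. *)
Fixpoint weave hs (ks : seq 'I_n) : seq 'I_n :=
  inorder (head Leaf hs) ++ (if ks is k :: ks' then k :: weave (behead hs) ks' else [::]).

Lemma weave_cat hs ks1 k ks2 : weave hs (ks1 ++ k :: ks2) =
  weave (take (size ks1).+1 hs) ks1 ++ k :: weave (drop (size ks1).+1 hs) ks2.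
Proof.
elim: ks1 hs => [|k1 ks1 IH] [|h hs] /=; rewrite ?cats0 ?take0 ?drop0 //.
- by congr cons; rewrite IH.
- by rewrite -catA /= IH.
Qed.

Lemma inorder_graft A hs : inorder (graft A hs) = weave hs (inorder A).
Proof.
elim: A hs => [|l IHl k r IHr] hs /=; first by rewrite cats0.
by rewrite weave_cat IHl IHr.
Qed.

Lemma mem_weave hs ks x : reflect
  (x \in ks \/ exists2 i, (i <= size ks)%N & x \in keys (nth Leaf hs i))
  (x \in weave hs ks).
Proof.
elim: ks hs => [|k ks IH] hs /=; rewrite mem_cat.
  rewrite -nth0 orbF; apply: (iffP idP) => [xh|].
    by right; exists 0%N; rewrite // inE.
  by case=> // -[[|//] _]; rewrite inE.
rewrite !inE -nth0; apply: (iffP or3P) => [[xh|/eqP->|/IH[xks|[i ile xi]]]|].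
- by right; exists 0%N; rewrite // inE.
- by left; rewrite eqxx.
- by left; rewrite xks orbT.
- by right; exists i.+1 => //; rewrite nth_behead in xi.
case=> [/orP[/eqP->|xks]|[[|i] ile]].
- by constructor 2.
- by constructor 3; apply/IH; left.
- by rewrite inE; constructor 1.
- by move=> xi; constructor 3; apply/IH; right; exists i; rewrite ?nth_behead.
Qed.

Lemma weave_disjoint hs ks x i : uniq (weave hs ks) -> (i <= size ks)%N ->
  x \in ks -> x \notin keys (nth Leaf hs i).
Proof.
elim: ks hs i => [|k ks IH] hs i //=; rewrite cat_uniq /=.
case/and4P=> _ /norP[kh hw] kw uw; rewrite inE => ile.
case: i ile => [|i] ile.
  rewrite nth0 inE; case/predU1P=> [-> //|xks]; apply/negP=> xh.
  by case/hasP: hw; exists x => //; apply/mem_weave; left.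
case/predU1P=> [->|xks]; last by rewrite -nth_behead IH.
by apply: contra kw => kh'; apply/mem_weave; right; exists i; rewrite ?nth_behead.
Qed.

Lemma mem_graft A hs x : reflect
  (x \in keys A \/ exists2 i, (i <= size (inorder A))%N & x \in keys (nth Leaf hs i))
  (x \in keys (graft A hs)).
Proof. by rewrite !inE inorder_graft; apply: mem_weave. Qed.

(** Comparisons with the keys of [A] lead the search for [a] into gap [i], whatever the shape of
    [A]. *)
Lemma subkeys_graft_pendant A hs i a : search_tree (graft A hs) ->
  (i <= size (inorder A))%N -> a \in keys (nth Leaf hs i) ->
  subkeys (graft A hs) a = subkeys (nth Leaf hs i) a.
Proof.
elim: A hs i => [|l IHl k r IHr] hs i /=; first by rewrite -nth0; case: i.
case/search_tree_node=> sl sr lk kr; rewrite size_cat /= addnS => ile ai.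
rewrite subkeys_node; case: (leqP i (size (inorder l))) => il.
  have ai' : a \in keys (nth Leaf (take (size (inorder l)).+1 hs) i).
    by rewrite nth_take.
  have ak : (a < k)%N by apply: lk; apply/mem_graft; right; exists i.
  rewrite ak ifF ?(IHl _ i) ?nth_take //.
  by apply/eqP=> E; rewrite E ltnn in ak.
have [j Ei] : exists j, (i = (size (inorder l)).+1 + j)%N.
  by exists (i - (size (inorder l)).+1)%N; order_lia.
have jle : (j <= size (inorder r))%N by order_lia.
have ai' : a \in keys (nth Leaf (drop (size (inorder l)).+1 hs) j).
  by rewrite nth_drop -Ei.
have ka : (k < a)%N by apply: kr; apply/mem_graft; right; exists j.
rewrite ifF ?ifF ?(IHr _ j) ?nth_drop -?Ei //; first by order_lia.
by apply/eqP=> E; rewrite E ltnn in ka.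
Qed.

(** The subtree of [a] in the graft is its subtree in [A] with pendants added, and [x] lies in no
    pendant. *)
Lemma subkeys_graft A hs a x : search_tree A -> a \in keys A ->
  (forall i, (i <= size (inorder A))%N -> x \notin keys (nth Leaf hs i)) ->
  (x \in subkeys (graft A hs) a) = (x \in subkeys A a).
Proof.
elim: A hs => [|l IHl k r IHr] hs; first by rewrite !inE.
case/search_tree_node=> sl sr lk kr aA xhs.
rewrite [graft _ _]/= !subkeys_node; case: (eqVneq a k) => [_|nak].
  apply/(mem_graft (Node l k r) hs)/idP => [[//|[i ile]]|]; last by left.
  by rewrite (negPf (xhs i ile)).
rewrite in_keys_node (negPf nak) /= in aA.
case: ltnP => ak.
  apply: IHl => // [|i ile]; first by case/orP: aA => // /kr; order_lia.
  by rewrite nth_take ?xhs //= size_cat; order_lia.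
apply: IHr => // [|i ile]; first by case/orP: aA => // /lk; order_lia.
by rewrite nth_drop xhs //= size_cat /=; order_lia.
Qed.

(** * The tree after an access *)

Section Rearranged.
Variables (T A : tree n) (s : 'I_n).
Hypotheses (bstT : bst_on [set: 'I_n] T) (afterA : is_after_tree T s A).

(** Both sequences are strictly increasing and have the same elements. *)
Lemma inorder_after_tree : inorder A = inorder (path_tree T s).
Proof.
case: bstT => sT _; case: afterA => -[sA kA] _.
apply: (irr_sorted_eq lt_trans) => //; first by move=> x; rewrite /= ltnn.
  by apply: (subseq_sorted lt_trans (subseq_path_tree T s)).
by move=> x; move/setP/(_ x): kA; rewrite -keys_path_tree !inE.
Qed.

Lemma inorder_rearranged : inorder (rearranged T s A) = inorder T.
Proof.
by rewrite /rearranged inorder_graft inorder_after_tree -inorder_graft graft_path_tree.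
Qed.

Lemma bst_rearranged : bst_on [set: 'I_n] (rearranged T s A).
Proof. by rewrite /bst_on /keys inorder_rearranged. Qed.

Lemma subkeys_rearranged_path a x : a \in path_set T s -> x \in path_set T s ->
  (x \in subkeys (rearranged T s A) a) = (x \in subkeys A a).
Proof.
case: afterA => -[sA kA] _; rewrite -{1 2}kA => aA xA; apply: subkeys_graft => // i ile.
apply: (@weave_disjoint _ (inorder A)) => //; last by move: xA; rewrite inE.
rewrite -inorder_graft [inorder _]inorder_rearranged; case: bstT => sT _.
by apply: (sorted_uniq lt_trans) => // x0; rewrite ltnn.
Qed.

Lemma subkeys_rearranged_pendant a : a \notin path_set T s ->
  subkeys (rearranged T s A) a = subkeys T a.
Proof.
case: (bst_rearranged) => sT' _; case: (bstT) => sT kT aP.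
have : a \in keys T by rewrite kT inE.
rewrite -{1}(graft_path_tree T s) => /mem_graft[|[i ile ai]].
  by rewrite keys_path_tree (negPf aP).
rewrite (@subkeys_graft_pendant _ _ i) ?inorder_after_tree //.
by rewrite -{2}(graft_path_tree T s) (@subkeys_graft_pendant _ _ i) ?graft_path_tree.
Qed.

Lemma mem_path_set x : (x \in path_set T s) = (s \in subkeys T x).
Proof.
case: bstT => sT kT; rewrite inE mem_search_path //; last by rewrite kT inE.
by rewrite kT inE.
Qed.

Lemma target_in_path : s \in path_set T s.
Proof. by rewrite mem_path_set (family_refl (subkeys_family bstT)). Qed.

(** [s] is the root of [A], so antisymmetry excludes the other path nodes; a node off the path keeps
    its old subtree, which did not contain [s]. *)
Lemma subkeys_rearranged_target a : s \in subkeys (rearranged T s A) a -> a = s.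
Proof.
move=> sa; case: (boolP (a \in path_set T s)) => aP; last first.
  by move: sa; rewrite subkeys_rearranged_pendant // -mem_path_set (negPf aP).
move: sa; rewrite subkeys_rearranged_path ?target_in_path //.
case: afterA => -[sA kA]; case: A sA kA => // l k r sA kA [<-] ka.
by apply: (subkeys_anti sA) ka _; rewrite subkeys_node eqxx kA.
Qed.

End Rearranged.
End SearchTrees.

(** * Inequalities for sums and logarithms *)

Section RealLemmas.
Variable R : realType.

(** Raising the shift by one adds a telescoping sum, which is at most [hi - lo]. *)
Lemma sum_shift_le (g : nat -> R) (lo hi : R) (r m : nat) :
  (forall i, lo <= g i <= hi) ->
  \sum_(0 <= i < m) (g i - g (i + r)%N) <= r%:R * (hi - lo).
Proof.
move=> glh; elim: r => [|r IHr].
  by rewrite mul0r big1 // => i _; rewrite addn0 subrr.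
have -> : \sum_(0 <= i < m) (g i - g (i + r.+1)%N) =
    \sum_(0 <= i < m) (g i - g (i + r)%N) -
    \sum_(0 <= i < m) (g (i.+1 + r)%N - g (i + r)%N).
  by rewrite -sumrB; apply: eq_bigr => i _; rewrite addSnnS opprB addrA subrK.
rewrite (telescope_sumr (fun i => g (i + r)%N)) //.
have /andP[_ H1] := glh r; have /andP[H2 _] := glh (m + r)%N.
by rewrite mulrSr mulrDl mul1r add0n; lra.
Qed.

(** From ln t < t at t = e^K x / X comes ln x - ln X <= -K + e^K x / X, and x / X <= 1 - Y / X <= ln
    X - ln Y. *)
Lemma ln_subr_le (K x X Y : R) : 0 < x -> 0 < Y -> x + Y <= X ->
  ln x - ln X <= - K + expR K * (ln X - ln Y).
Proof.
move=> x0 Y0 xYX; have X0 : 0 < X by lra.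
have e0 := expR_gt0 K; have q0 : 0 < x / X by apply: divr_gt0.
have H1 : ln (expR K * (x / X)) <= expR K * (x / X).
  by apply/ltW/ln_sublinear/mulr_gt0.
have H2 : ln (Y / X) <= Y / X - 1.
  have := @le_ln1Dx R (Y / X - 1); rewrite addrCA subrr addr0; apply.
  by have := divr_gt0 Y0 X0; lra.
move: H1 H2; rewrite lnM ?posrE // !ln_div ?posrE // expRK => H1 H2.
have H3 : x / X <= 1 - Y / X.
  by rewrite -{1}(divff (lt0r_neq0 X0)) -mulrBl ler_pM2r ?invr_gt0 //; lra.
have H4 : expR K * (x / X) <= expR K * (ln X - ln Y) by rewrite ler_pM2l //; lra.
lra.
Qed.

End RealLemmas.

(** * Weights of key sets *)

Section Weight.
Variables (R : realType) (n : nat) (w : 'I_n -> R).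
Hypothesis w_gt0 : forall a, 0 < w a.

Lemma weight_sub (A B : {set 'I_n}) : A \subset B -> weight w A <= weight w B.
Proof.
move=> AB; rewrite /weight [leRHS](big_setID A) (setIidPr AB) /= lerDl.
by apply: sumr_ge0 => *; apply: ltW.
Qed.

Lemma weight_gt0 (A : {set 'I_n}) a : a \in A -> 0 < weight w A.
Proof.
move=> aA; rewrite /weight (bigD1 a) //=; apply: ltr_pwDl => //.
by apply: sumr_ge0 => *; apply: ltW.
Qed.

Lemma weight_ge (A : {set 'I_n}) a : a \in A -> w a <= weight w A.
Proof.
move=> aA; rewrite /weight (bigD1 a) //= lerDl.
by apply: sumr_ge0 => *; apply: ltW.
Qed.

End Weight.

(** * Subtrees of the nodes on one side of the accessed key *)

Section OneSide.
Variables (R : realType) (n : nat) (rk : 'I_n -> nat).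
Hypothesis rk_inj : injective rk.
Variables (T T' : 'I_n -> {set 'I_n}) (P : {set 'I_n}) (s : 'I_n).
Hypotheses (famT : search_family rk T) (famT' : search_family rk T').
Hypothesis memP : forall x, (x \in P) = (s \in T x).
Hypothesis T'_out : forall a, a \notin P -> T' a = T a.
Hypothesis T'_root : forall a, s \in T' a -> a = s.
Variable N : nat.
Hypothesis few_gained : forall y, y \in P -> y != s ->
  (#|[set x in P | (x \notin T y) && (x \in T' y)]| <= N)%N.

(** With [rk] equal to [val] these are the path nodes left of [s]; with [n - x] in its place, those
    right of it. *)
Definition side : {set 'I_n} := [set x in P | (rk x < rk s)%N].

(** On one side of [s], larger rank means deeper in the path, so [x] is a descendant of [a] in [T],
    and one that [a] loses. *)
Definition shrunk : {set 'I_n} :=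
  [set a in side | [exists x in side, (rk a < rk x)%N && (x \notin T' a)]].

Let ordered : seq 'I_n := sort (relpre rk leq) (enum side).

(** The side from its topmost node down; past the end the default [s] acts as the node below all of
    them. *)
Let q i := nth s ordered i.

Let size_side : size ordered = #|side|.
Proof. by rewrite size_sort cardE. Qed.

Let q_side i : (i < #|side|)%N -> q i \in side.
Proof.
by move=> il; rewrite -mem_enum -(mem_sort (relpre rk leq)) mem_nth // size_side.
Qed.

Let q_out i : (#|side| <= i)%N -> q i = s.
Proof. by move=> il; rewrite /q nth_default // size_side. Qed.

Let qP a : a \in side -> exists2 i, (i < #|side|)%N & q i = a.
Proof.
rewrite -mem_enum -(mem_sort (relpre rk leq)) => aS.
by exists (index a ordered); rewrite -?size_side ?index_mem // /q nth_index.
Qed.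

Let q_lt i j : (i < j)%N -> (i < #|side|)%N -> (rk (q i) < rk (q j))%N.
Proof.
move=> ij il; case: (ltnP j #|side|) => jl; last first.
  by rewrite (q_out jl); have := q_side il; rewrite inE => /andP[].
have le_ij : (rk (q i) <= rk (q j))%N.
  have := @sorted_ltn_nth _ (relpre rk leq) _ s ordered.
  apply; rewrite ?inE ?size_side //; first by move=> ? ? ?; apply: leq_trans.
  by apply: sort_sorted => x y; apply: leq_total.
rewrite ltn_neqAle le_ij andbT; apply/eqP=> /rk_inj/eqP.
by rewrite nth_uniq ?size_side ?sort_uniq ?enum_uniq // => /eqP E; rewrite E ltnn in ij.
Qed.

Let q_le i j : (i <= j)%N -> (rk (q i) <= rk (q j))%N.
Proof.
rewrite leq_eqVlt => /orP[/eqP->//|ij].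
case: (ltnP i #|side|) => il; first by rewrite ltnW ?q_lt.
by rewrite !q_out // (leq_trans il) // ltnW.
Qed.

Let q_le_s i : (rk (q i) <= rk s)%N.
Proof. by rewrite -(@q_out (#|side| + i)) ?q_le ?leq_addl ?leq_addr. Qed.

Let sP : s \in P.
Proof. by rewrite memP (family_refl famT). Qed.

Let q_P i : q i \in P.
Proof.
case: (ltnP i #|side|) => il; last by rewrite q_out.
by have := q_side il; rewrite inE => /andP[].
Qed.

(** [q j] lies between [q i] and [s], both of which are in the convex set [T (q i)]. *)
Let q_sub i j : (i <= j)%N -> T (q j) \subset T (q i).
Proof.
move=> ij; apply: (family_trans famT).
apply: (family_convex famT (family_refl famT (q i)) _ (q_le ij) (q_le_s j)).
by rewrite -memP.
Qed.

Let q_notin i j : (i < j)%N -> (i < #|side|)%N -> q i \notin T (q j).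
Proof.
move=> ij il; apply/negP=> iTj.
have jTi : q j \in T (q i).
  by apply: (subsetP (q_sub (ltnW ij))); apply: (family_refl famT).
by have := q_lt ij il; rewrite (family_anti famT iTj jTi) ltnn.
Qed.

(** The nodes [q t] with [i <= t < j] are distinct, as [q] is strictly increasing in rank below
    [#|side|], and [y] gains all of them. *)
Let gained_bound y i j : (j <= #|side|)%N -> y \in P -> y != s ->
  (forall t, (i <= t)%N -> (t < j)%N -> (q t \notin T y) && (q t \in T' y)) ->
  (j - i <= N)%N.
Proof.
move=> jl yP ys gain; apply: leq_trans (few_gained yP ys).
pose f := [seq q t | t <- iota i (j - i)].
have -> : (j - i)%N = size f by rewrite size_map size_iota.
rewrite cardE; apply: uniq_leq_size.
  rewrite map_inj_in_uniq ?iota_uniq // => u v; rewrite !mem_iota => ui vi E.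
  have lt_side t : (i <= t < i + (j - i))%N -> (t < #|side|)%N.
    by move: jl; clear; lia.
  case: (ltngtP u v) => // uv.
    by have := q_lt uv (lt_side _ ui); rewrite E ltnn.
  by have := q_lt uv (lt_side _ vi); rewrite E ltnn.
move=> x /mapP[t]; rewrite mem_iota => ti ->; rewrite mem_enum inE q_P /=.
by apply: gain; move: ti; clear; lia.
Qed.

Let side_neq a : a \in side -> a != s.
Proof. by rewrite inE => /andP[_]; apply: contraTneq => ->; rewrite ltnn. Qed.

(** Otherwise convexity would put the new root [s] into [T' a]. *)
Let T'_below_s a k : a \in side -> k \in T' a -> (rk k < rk s)%N.
Proof.
move=> aS kTa; rewrite ltnNge; apply/negP=> sk.
have : s \in T' a.
  apply: (family_convex famT' (family_refl famT' a) kTa _ sk).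
  by move: aS; rewrite inE => /andP[_ /ltnW].
by move=> /T'_root E; have := side_neq aS; rewrite E eqxx.
Qed.

Let above_in_P x z : x \in P -> x \in T z -> z \in P.
Proof. by rewrite !memP => sx /(family_trans famT)/subsetP; apply. Qed.

(** A key [k] of [T' (q j)] outside [T x] lies below [x], and its lowest common ancestor with [x] in
    [T] is a node [q i] of the side above [x]. By convexity [q j] would gain everything from [q i]
    to [q (j - 1)]. For [j <= N] no such [i] exists, as [x] is then [q 0]. *)
Let T'_sub j : (j < #|side|)%N -> T' (q j) \subset T (q (j - N)).
Proof.
move=> jl; have jS := q_side jl; apply/subsetP=> k kTj.
have ks := T'_below_s jS kTj; set x := q (j - N).
case: (leqP (rk x) (rk k)) => [xk|kx].
  apply: (family_convex famT (family_refl famT x) _ xk (ltnW ks)).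
  by rewrite -memP q_P.
have xq : (rk x <= rk (q j))%N by apply: q_le; rewrite leq_subr.
have xT : x \in T' (q j).
  by apply: (family_convex famT' kTj (family_refl famT' _)) => //; apply: ltnW.
have [z [kz zx kTz xTz]] := family_lca famT (ltnW kx).
have zP : z \in P by apply: above_in_P xTz; apply: q_P.
have [zex|zx'] := eqVneq (rk z) (rk x); first by rewrite -(rk_inj zex).
have zltx : (rk z < rk x)%N by rewrite ltn_neqAle zx' zx.
have zS : z \in side by rewrite inE zP (leq_trans zltx) ?q_le_s.
have zT : z \in T' (q j) by apply: (family_convex famT' kTj xT).
have [i il zE] := qP zS.
have ij : (i < j - N)%N.
  rewrite ltnNge; apply/negP=> /q_le; rewrite zE -/x => xz.
  by rewrite ltnNge xz in zltx.
suff: (j - i <= N)%N by move: ij; clear; lia.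
apply: (gained_bound (y := q j)); rewrite ?q_P ?side_neq // ?(ltnW jl) //.
move=> t it tj; rewrite q_notin ?(ltn_trans tj jl) //=.
apply: (family_convex famT' zT (family_refl famT' _)); last by apply/q_le/ltnW.
by rewrite -zE q_le.
Qed.

Let T'_disjoint j : (j < #|side|)%N -> q j \in shrunk ->
  [disjoint T' (q j) & T (q (j + N.+1))].
Proof.
move=> jl; rewrite inE (q_side jl) /= => /exists_inP[x xS /andP[jx xT']].
(* [z] is the lowest common ancestor after the access. Off the path its subtree would be unchanged
   and, containing [q j], would put [z] on the path. *)
have [z [jz zx jTz xTz]] := family_lca famT' (ltnW jx).
have zP : z \in P.
  apply/negPn/negP=> zP; move: (zP); rewrite (@above_in_P (q j)) //.
  by rewrite -(T'_out zP).
have zS : z \in side.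
  by move: xS; rewrite !inE zP => /andP[_] /=; apply: leq_ltn_trans.
have zj : z != q j by apply: contraNneq xT' => <-.
have [k kl zE] := qP zS.
have jk : (j < k)%N.
  rewrite ltnNge; apply/negP=> /q_le; rewrite zE => zj'.
  by case/eqP: zj; apply: rk_inj; apply/eqP; rewrite eqn_leq zj' jz.
have kj : (k - j <= N)%N.
  apply: (gained_bound (y := z)); rewrite ?side_neq // ?(ltnW kl) //.
  move=> t jt tk; rewrite -{1}zE q_notin ?(ltn_trans tk kl) //=.
  apply: (family_convex famT' jTz (family_refl famT' _)); rewrite ?q_le //.
  by rewrite -zE q_le // ltnW.
(* [T z] itself may contain keys below [z]; only the subtree of the next node [q k.+1] lies beyond
   [z]. *)
have kjN : (k.+1 <= j + N.+1)%N by move: kj; clear; lia.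
apply: disjointWr (q_sub kjN) _.
apply/pred0P=> u /=; apply/negP=> /andP[uj uk].
(* [T' (q j)] stays below [z], since by convexity it would otherwise contain its own proper ancestor
   [z]. *)
have uz : (rk u < rk z)%N.
  rewrite ltnNge; apply/negP=> zu.
  have zj' : z \in T' (q j) by apply: (family_convex famT' (family_refl famT' _) uj).
  by move: zj; rewrite (family_anti famT' zj' jTz) eqxx.
have := q_notin (ltnSn k) kl; rewrite zE.
rewrite (family_convex famT uk (family_refl famT _)) //; first exact: ltnW.
by rewrite -zE q_le.
Qed.

(** * Counting shrunk nodes *)

(** At the deepest node [x] of the side, every lost ancestor on the same side is shrunk. Ancestors
    on the other side may all be lost; each then takes 1 from the losses but contributed 1/2 + eps
    to the demand, which leaves 1/2 - eps. *)
Lemma side_count (eps c : R) : 0 < eps -> eps <= 2^-1 -> 0 <= c ->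
  (forall x, x \in side ->
    (2^-1 + eps) * #|[set y in P | (x != y) && (x \in T y)]|%:R - c
      <= #|[set y in P | [&& x != y, x \in T y & x \notin T' y]]|%:R) ->
  (2^-1 + eps) * (#|side|%:R - 1) - c <=
    (2^-1 - eps) * #|[set x in P | (rk s < rk x)%N]|%:R + #|shrunk|%:R.
Proof.
move=> eps0 eps1 c0 loses; set other := [set x in P | _].
have half_eps : 0 <= 2^-1 - eps by rewrite subr_ge0.
case: (set_0Vmem side) => [-> | [x0 x0S]].
  rewrite cards0 sub0r mulrN1; apply: (@le_trans _ _ 0); first by lra.
  by rewrite addr_ge0 ?mulr_ge0.
case: (arg_maxnP rk x0S) => x /= xS xmax.
have {}xS : x \in side by exact: xS.
have lt_x y : y \in side -> x != y -> (rk y < rk x)%N.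
  move=> yS xy; rewrite ltn_neqAle; apply/andP; split; last exact: xmax.
  by apply: contra xy => /eqP/rk_inj->.
(* The ancestors of [x] beyond [s]: their loss yields no shrunk node of this side. *)
pose across := [set y in other | x \in T y].
have ancE : (#|side|.-1 + #|across| <= #|[set y in P | (x != y) && (x \in T y)]|)%N.
  have -> : #|side|.-1 = #|side :\ x| by rewrite (cardsD1 x side) xS.
  have dis : (side :\ x) :&: across = set0.
    apply/setP=> y; rewrite !inE; apply/negP.
    by case/andP=> /and3P[_ _ H1] /andP[/andP[_ H2] _]; rewrite ltnNge ltnW in H2.
  rewrite -cardsUI dis cards0 addn0; apply: subset_leq_card.
  apply/subsetP=> y /setUP[/setD1P[yx yS]|].
    have := yS; rewrite !inE => /andP[yP ys]; rewrite yP eq_sym yx /=.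
    move: (yP); rewrite memP; move/(family_convex famT (family_refl famT y)); apply.
      by apply/ltnW/lt_x; rewrite // eq_sym.
    by move: xS; rewrite inE => /andP[_ /ltnW].
  rewrite !inE => /andP[/andP[yP sy] xy]; rewrite yP xy andbT /=.
  apply: contraTneq sy => <-; rewrite -leqNgt.
  by move: xS; rewrite inE => /andP[_ /ltnW].
have lostE : (#|[set y in P | [&& x != y, x \in T y & x \notin T' y]]|
    <= #|shrunk| + #|across|)%N.
  apply: leq_trans (leq_card_setU _ _); apply: subset_leq_card.
  apply/subsetP=> y; rewrite inE => /and4P[yP xy xT xT'].
  case: (ltngtP (rk y) (rk s)) => [ys|sy|/rk_inj ys].
  - have yS : y \in side by rewrite inE yP.
    apply/setUP; left; rewrite inE yS /=; apply/exists_inP; exists x => //.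
    by rewrite lt_x.
  - by apply/setUP; right; rewrite !inE yP sy.
  - case/eqP: xy; rewrite ys in xT *; symmetry; apply: (family_anti famT) xT _.
    by rewrite -memP; move: xS; rewrite inE => /andP[].
have acrossE : #|across|%:R <= #|other|%:R :> R.
  by rewrite ler_nat subset_leq_card //; apply/subsetP=> y; rewrite inE => /andP[].
have := loses _ xS.
set anc := #|[set y in P | _]| in ancE *; set lost := #|[set y in P | _]| in lostE *.
have : (#|side|%:R - 1 + #|across|%:R <= anc%:R :> R).
  have S0 : (0 < #|side|)%N by apply/card_gt0P; exists x.
  by rewrite -(prednK S0) -natr1 addrK -natrD ler_nat.
have : lost%:R <= #|shrunk|%:R + #|across|%:R :> R by rewrite -natrD ler_nat.
move=> H1 H2 H3.
have H4 : (2^-1 + eps) * (#|side|%:R - 1 + #|across|%:R) <= (2^-1 + eps) * anc%:R.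
  by apply: ler_wpM2l => //; lra.
have H5 := ler_wpM2l half_eps acrossE.
lra.
Qed.

(** * Potential drop on one side *)

Variable w : 'I_n -> R.
Hypothesis w_gt0 : forall a, 0 < w a.

Lemma side_potential_drop (K : R) :
  \sum_(a in side) (ln (weight w (T' a)) - ln (weight w (T a))) <=
  - K * #|shrunk|%:R +
    (1 + expR K) * ((2 * N).+1%:R * (ln (weight w [set: 'I_n]) - ln (w s))).
Proof.
pose g i := ln (weight w (T (q i))).
have wT i : 0 < weight w (T (q i)) by apply: (weight_gt0 w_gt0 (family_refl famT _)).
have wT' i : 0 < weight w (T' (q i)) by apply: (weight_gt0 w_gt0 (family_refl famT' _)).
have g_mono i j : (i <= j)%N -> g j <= g i.
  by move=> ij; rewrite ler_ln ?posrE ?weight_sub ?q_sub.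
(* The summand 1 in [1 + expR K] pays for replacing [g j] by [g (j - N)], the summand [expR K] for
   the gain of [K] at a shrunk node. *)
have bnd j : (j < #|side|)%N -> ln (weight w (T' (q j))) - g j <=
    - K * (q j \in shrunk)%:R + (1 + expR K) * (g (j - N)%N - g (j + N.+1)%N).
  move=> jl; have e0 := expR_gt0 K.
  have g1 : g j <= g (j - N)%N by apply: g_mono; rewrite leq_subr.
  have g2 : g (j + N.+1)%N <= g j by apply: g_mono; rewrite leq_addr.
  have g3 : ln (weight w (T' (q j))) <= g (j - N)%N.
    by rewrite ler_ln ?posrE ?weight_sub ?T'_sub.
  rewrite mulrDl mul1r; case: (boolP (q j \in shrunk)) => jS.
    rewrite mulr1; suff: ln (weight w (T' (q j))) - g (j - N)%N <=
      - K + expR K * (g (j - N)%N - g (j + N.+1)%N).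
      by move: g1 g2 g3; lra.
    apply: ln_subr_le => //.
    have -> : weight w (T' (q j)) + weight w (T (q (j + N.+1))) =
        weight w (T' (q j) :|: T (q (j + N.+1))).
      by rewrite /weight -bigU ?T'_disjoint //; apply: eq_bigl => u; rewrite !inE.
    rewrite weight_sub // subUset T'_sub // q_sub //.
    by rewrite (leq_trans (leq_subr _ _)) ?leq_addr.
  rewrite mulr0 add0r.
  have : 0 <= expR K * (g (j - N)%N - g (j + N.+1)%N).
    by apply: mulr_ge0; [exact: ltW | move: g1 g2; lra].
  by move: g1 g2 g3; lra.
have sumE (F : 'I_n -> R) : \sum_(a in side) F a = \sum_(0 <= i < #|side|) F (q i).
  rewrite -big_enum /= -(perm_big _ (permEl (perm_sort (relpre rk leq) _))) /=.
  by rewrite (big_nth s) size_side.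
have -> : #|shrunk|%:R = \sum_(a in side) (a \in shrunk)%:R :> R.
  rewrite -sum1_card natr_sum big_mkcond [RHS]big_mkcond; apply: eq_bigr => a _.
  by rewrite [a \in shrunk]inE; case: (a \in side) => //=; case: ifP.
rewrite !sumE mulr_sumr.
apply: (@le_trans _ _ (\sum_(0 <= j < #|side|) (- K * (q j \in shrunk)%:R +
  (1 + expR K) * (g (j - N)%N - g (j + N.+1)%N)))).
  by apply: ler_sum_nat => j /andP[_]; apply: bnd.
have e1 : 0 < 1 + expR K by rewrite addr_gt0 ?expR_gt0.
rewrite big_split /= lerD2l -mulr_sumr ler_pM2l //.
(* Seen through [i - N], the two indices differ by a shift of [2 * N + 1]. *)
apply: le_trans (_ : \sum_(0 <= i < #|side|)
  (g (i - N)%N - g (i + (2 * N).+1 - N)%N) <= _).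
  apply: ler_sum_nat => i _.
  by rewrite (_ : i + (2 * N).+1 - N = i + N.+1)%N //; clear; lia.
apply: (sum_shift_le (g := fun i => g (i - N)%N)) => i.
(* Every [T (q i)] contains [s], so its weight lies between [w s] and the total weight. *)
have sT : s \in T (q (i - N)) by rewrite -memP q_P.
rewrite !ler_ln ?posrE ?wT ?w_gt0 ?(weight_gt0 w_gt0 (in_setT s)) //.
by rewrite weight_ge ?(weight_sub w_gt0) ?subsetT.
Qed.

End OneSide.

(** * Both sides together, in natural logarithms *)

(** In the factor of the last logarithm, 1 stands for [s] itself and each side contributes
    [(1 + expR K) * (2 * N).+1]. *)
Lemma access_bound_ln (R : realType) (n : nat) (T : tree n) (s : 'I_n) (A : tree n)
    (w : 'I_n -> R) (eps c K : R) (N : nat) :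
  bst_on [set: 'I_n] T -> is_after_tree T s A -> (forall a, 0 < w a) ->
  0 < eps -> eps <= 2^-1 -> 0 <= c -> 0 <= K ->
  (forall x, x \in path_set T s ->
     (2^-1 + eps) * #|path_ancestors T s x|%:R - c <= #|lost_ancestors T s A x|%:R) ->
  (forall y, y \in path_set T s -> y != s ->
     (#|gained_descendants T s A y| <= N)%N) ->
  K * (2 * eps * (#|path_set T s|%:R - 2) - 1 - 2 * c) <=
    \sum_a ln (weight w (subkeys T a))
    - \sum_a ln (weight w (subkeys (rearranged T s A) a))
    + (1 + 2 * (1 + expR K) * (2 * N).+1%:R) * ln (weight w [set: 'I_n] / w s).
Proof.
move=> bstT afterA w0 eps0 eps1 c0 K0 loses gains.
set T' := subkeys (rearranged T s A); set P := path_set T s.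
have famT := subkeys_family bstT.
have famT' : search_family val T' := subkeys_family (bst_rearranged bstT afterA).
have memP := mem_path_set s bstT.
have out := subkeys_rearranged_pendant bstT afterA.
have root := subkeys_rearranged_target bstT afterA.
have sP := target_in_path s bstT.
have pathE := subkeys_rearranged_path bstT afterA.
have few y : y \in P -> y != s ->
    (#|[set x in P | (x \notin subkeys T y) && (x \in T' y)]| <= N)%N.
  move=> yP ys; apply: leq_trans (gains y yP ys); apply: subset_leq_card.
  apply/subsetP=> x; rewrite in_set => /and3P[xP xT xT'].
  rewrite in_set xP /ancestor (negPf xT) andbF -pathE // xT' andbT /=.
  by apply: contraNneq xT => ->; rewrite (family_refl famT).
have many x : x \in P -> (2^-1 + eps) *
    #|[set y in P | (x != y) && (x \in subkeys T y)]|%:R - c <=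
    #|[set y in P | [&& x != y, x \in subkeys T y & x \notin T' y]]|%:R.
  move=> xP; apply: le_trans (loses x xP) _; rewrite ler_nat subset_leq_card //.
  apply/subsetP=> y; rewrite /lost_ancestors in_set /ancestor.
  case/and3P=> yP /andP[xy xT]; rewrite xy /= -pathE // => xT'.
  by rewrite in_set yP xy xT.
have rev_inj : injective (fun x : 'I_n => (n - x)%N).
  by move=> x y xy; apply: val_inj;
    have := ltn_ord x; have := ltn_ord y; simpl in *; lia.
have fam_rT := search_family_rev famT; have fam_rT' := search_family_rev famT'.
pose L := side val P s; pose Rt := side (fun x : 'I_n => (n - x)%N) P s.
have RtE : Rt = [set x in P | (val s < val x)%N].
  apply/setP=> x; rewrite !inE; congr (_ && _) => /=.
  by have := ltn_ord x; have := ltn_ord s; lia.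
have LE : L = [set x in P | (n - s < n - x)%N].
  apply/setP=> x; rewrite !inE; congr (_ && _) => /=.
  by have := ltn_ord x; have := ltn_ord s; lia.
have subP rk x : x \in side rk P s -> x \in P by rewrite inE => /andP[].
have dropL := side_potential_drop val_inj famT famT' memP out root few w0 K.
have dropR := side_potential_drop rev_inj fam_rT fam_rT' memP out root few w0 K.
have countL := side_count (s := s) val_inj famT memP eps0 eps1 c0
  (fun x xL => many x (subP _ x xL)).
have countR := side_count (s := s) rev_inj fam_rT memP eps0 eps1 c0
  (fun x xL => many x (subP _ x xL)).
rewrite -/L in dropL countL; rewrite -/Rt in dropR countR.
rewrite -RtE in countL; rewrite -LE in countR.
have splitP (V : nmodType) (F : 'I_n -> V) :
    \sum_(a in P) F a = F s + (\sum_(a in L) F a + \sum_(a in Rt) F a).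
  rewrite (bigD1 s) //=; congr (_ + _); rewrite (bigID (fun x : 'I_n => (x < s)%N)) /=.
  congr (_ + _); apply: eq_bigl => x; rewrite ?RtE !inE.
    case: ltnP; rewrite ?andbF // => xs; rewrite (_ : x != s) ?andbT //.
    by apply: contraTneq xs => ->; rewrite ltnn.
  by rewrite -leqNgt -andbA [in RHS]ltn_neqAle eq_sym.
have cardP : #|P|%:R = 1 + (#|L|%:R + #|Rt|%:R) :> R.
  by rewrite -!sum1_card !natr_sum splitP.
have W0 : 0 < weight w [set: 'I_n] by apply: (weight_gt0 w0 (in_setT s)).
(* Nodes off the path keep their subtrees, so their terms cancel. *)
have sumE : \sum_a ln (weight w (subkeys T a)) - \sum_a ln (weight w (T' a)) =
    - \sum_(a in P) (ln (weight w (T' a)) - ln (weight w (subkeys T a))).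
  rewrite -sumrB -sumrN (bigID (mem P)) /= [X in _ + X]big1 ?addr0.
    by apply: eq_bigr => a _; rewrite opprB.
  by move=> a aP; rewrite /T' out // subrr.
rewrite sumE splitP ln_div ?posrE // cardP.
set B := ln _ - ln (w s) in dropL dropR *.
have targetE : ln (weight w (T' s)) - ln (weight w (subkeys T s)) <= B.
  have sTs := family_refl famT s; have sTs' := family_refl famT' s.
  apply: lerB; rewrite ler_ln ?posrE ?w0 ?(weight_gt0 w0 sTs) ?(weight_gt0 w0 sTs') //.
    by rewrite weight_sub ?subsetT.
  exact: weight_ge.
set u := #|shrunk val _ _ _|%:R in dropL countL.
set v := #|shrunk _ _ _ _|%:R in dropR countR.
(* In the sum of the two counts, 1/2 + eps against 1/2 - eps leaves 2 eps for every node of either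
   side. *)
have H : K * (2 * eps * (1 + (#|L|%:R + #|Rt|%:R) - 2) - 1 - 2 * c) <= K * (u + v).
  by apply: ler_wpM2l => //; lra.
lra.
Qed.

(** * Choice of the constants and passage to binary logarithms *)

Theorem theorem10 (R : realType) (alg : algorithm)
    (alg_msa : minimally_self_adjusting alg)
    (eps c D : R) (eps_gt0 : 0 < eps) (c_gt0 : 0 < c) (D_gt0 : 0 < D)
    (depth_halving :
      forall (n : nat) (T : tree n) (s : 'I_n) (A : tree n),
        bst_on [set: 'I_n] T -> alg n T s A ->
        forall x : 'I_n, x \in path_set T s ->
          (2^-1 + eps) * #|path_ancestors T s x|%:R - c
            <= #|lost_ancestors T s A x|%:R)
    (few_gained :
      forall (n : nat) (T : tree n) (s : 'I_n) (A : tree n),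
        bst_on [set: 'I_n] T -> alg n T s A ->
        forall y : 'I_n, y \in path_set T s -> y != s ->
          #|gained_descendants T s A y|%:R <= D) :
  access_lemma R alg.
Proof.
(* The loss condition weakens as eps decreases, so eps may be capped at 1/2, which keeps 1/2 - e
   nonnegative. *)
pose e := Num.min eps 2^-1; pose N := Num.bound D.
have e0 : 0 < e by rewrite lt_min eps_gt0 invr_gt0 ltr0n.
have e_eps : e <= eps by rewrite ge_min lexx.
have e_half : e <= 2^-1 by rewrite ge_min lexx orbT.
have ln2 : 0 < ln 2 :> R by rewrite ln_gt0 // ltr1n.
(* Makes [K * (2 * e)] equal to [ln 2], one unit of binary potential per path node; [M] below
   collects the additive losses. *)
pose K := ln 2 / (2 * e).
have K0 : 0 <= K by rewrite divr_ge0 ?mulr_ge0 // ltW.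
pose C : R := 1 + 2 * (1 + expR K) * (2 * N).+1%:R.
have C0 : 0 <= C by rewrite addr_ge0 // !mulr_ge0 // addr_ge0 // expR_ge0.
pose M := 2 + (1 + 2 * c) / (2 * e).
have M0 : 0 <= M.
  by rewrite addr_ge0 // divr_ge0 ?addr_ge0 ?mulr_ge0 // ltW.
(* [C] multiplies the logarithm and [M] the 1; the two cross terms are nonnegative because [w s] is
   at most the total weight. *)
exists (C + M) => n T w s A bstT w0 algA.
have [_ /(_ A algA) afterA] := alg_msa n T s bstT.
have Hln : K * (2 * e * (#|path_set T s|%:R - 2) - 1 - 2 * c) <=
    \sum_a ln (weight w (subkeys T a))
    - \sum_a ln (weight w (subkeys (rearranged T s A) a))
    + C * ln (weight w [set: 'I_n] / w s).
  apply: access_bound_ln => // [|x xP|y yP ys]; first exact: ltW.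
    apply: le_trans (depth_halving n T s A bstT algA x xP).
    by rewrite lerD2r ler_wpM2r // lerD2l.
  rewrite -(ler_nat R); apply: le_trans (few_gained n T s A bstT algA y yP ys) _.
  by apply/ltW/archi_boundP/ltW.
have B0 : 0 <= log2 (weight w [set: 'I_n] / w s).
  rewrite divr_ge0 ?(ltW ln2) // ln_ge0 // ler_pdivlMr // mul1r.
  by rewrite weight_ge ?inE.
have pE t : potential w t = (\sum_a ln (weight w (subkeys t a))) / ln 2.
  by rewrite mulr_suml.
have KE : K * (2 * e * (#|path_set T s|%:R - 2) - 1 - 2 * c) =
    ln 2 * (#|path_set T s|%:R - M).
  by rewrite /K /M; field; rewrite gt_eqF.
rewrite {}KE -(ler_pM2r (_ : 0 < (ln 2)^-1)) ?invr_gt0 // in Hln.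
rewrite mulrDl mulrBl -!pE -(mulrA C) -/(log2 _) mulrAC divff ?gt_eqF // mul1r in Hln.
have := mulr_ge0 M0 B0; lra.
Qed.
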